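(* Let $r \ge 1$ and $\delta \ge 1$ be integers, and let $H$ be an $r$-uniform hypergraph with $\delta^*(H)=\delta$. Then for all integers $n \ge |V(H)|$, \[\mathrm{wsat}(n,H)\ge \left(\frac{\delta}{r}-\frac{1}{\binom{r+\delta-1}{r-1}}\right)\binom{n}{r-1}.\]
   Context: An $r$-uniform hypergraph $H$ has a finite vertex set $V(H)$ and edge set $E(H)\subseteq\binom{V(H)}{r}$ (where $\binom{T}{k}$ is the set of $k$-element subsets of $T$); $H$ is non-empty if $|E(H)|\ge1$. $K_n^r$ denotes the complete $r$-uniform hypergraph on $n$ vertices. For a non-empty $r$-uniform $H$, an $r$-uniform hypergraph $F$ on $n$ vertices is weakly $H$-saturated if the edges of $E(K_n^r)\setminus E(F)$ can be ordered $e_1,\dots,e_k$ so that for each $i$, the hypergraph $F\cup\{e_1,\dots,e_i\}$ contains a copy of $H$ (a subhypergraph isomorphic to $H$) that contains the edge $e_i$. $\mathrm{wsat}(n,H)$ is the minimum number of edges of a weakly $H$-saturated $r$-uniform hypergraph on $n$ vertices. For $U\subseteq V(H)$ the link is $L_H(U)=\{e\setminus U : e\in E(H),\ U\subseteq e\}$. For non-empty $H$, $\delta^*(H)=\min\{|L_H(U)| : U\in\binom{V(H)}{r-1},\ |L_H(U)|\neq0\}$; for empty $H$, $\delta^*(H)=0$. *)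

(* Defs.v *)
From mathcomp Require Import all_boot.

Set Implicit Arguments.
Unset Strict Implicit.
Unset Printing Implicit Defensive.

(* Minimum of F over the indices satisfying P, with the junk value 0 when there
   is no such index; wsat_exists and delta_star_exists below show that the junk
   value is not reached in wsat, nor in delta_star for non-empty hypergraphs. *)
Definition min_over (I : finType) (P : pred I) (F : I -> nat) : nat :=
  if [pick i | P i] is Some i0 then F [arg min_(i < i0 | P i) F i] else 0.

Lemma min_overP (I : finType) (P : pred I) (F : I -> nat) (i0 : I) :
  P i0 -> exists i, [/\ P i, F i = min_over P F
                      & forall j, P j -> min_over P F <= F j].
Proof.
rewrite /min_over => Pi0; case: pickP => [i1 Pi1|/(_ i0)]; last by rewrite Pi0.
by case: arg_minnP => // i Pi le_i; exists i.
Qed.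

(* A hypergraph whose vertex set is the finite type V (all of it, isolated
   vertices included) is represented by its edge set, of type {set {set V}}. *)
Definition complete (r : nat) (V : finType) : {set {set V}} :=
  [set e : {set V} | #|e| == r].

Definition uniform (r : nat) (V : finType) (E : {set {set V}}) : bool :=
  E \subset complete r V.

Definition link (V : finType) (H : {set {set V}}) (U : {set V}) : {set {set V}} :=
  [set e :\: U | e in H & U \subset e].

Definition delta_star (r : nat) (V : finType) (H : {set {set V}}) : nat :=
  if H == set0 then 0 else
  min_over (fun U : {set V} => (#|U| == r - 1) && (#|link H U| != 0))
           (fun U => #|link H U|).

(* The image of the edges of H under an injection V -> W; the copies of H
   on vertices of W are the images of H under injections. *)
Definition image_edges (V W : finType) (f : {ffun V -> W}) (H : {set {set V}}) :
  {set {set W}} := [set f @: e | e : {set V} in H].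

Definition has_copy_through (V W : finType) (H : {set {set V}})
    (G : {set {set W}}) (e : {set W}) : bool :=
  [exists f : {ffun V -> W},
    [&& injectiveb f, image_edges f H \subset G & e \in image_edges f H]].

(* The tuple s lists the missing edges; its i-th entry (counting from 0) must
   lie in a copy of H inside F together with the entries 0, ..., i. *)
Definition weakly_saturated (r : nat) (V W : finType) (H : {set {set V}})
    (F : {set {set W}}) : bool :=
  [exists s : #|complete r W :\: F|.-tuple {set W},
    perm_eq s (enum (complete r W :\: F)) &&
    [forall i : 'I_#|complete r W :\: F|,
      has_copy_through H (F :|: [set e in take i.+1 s]) (tnth s i)]].

Definition wsat (r n : nat) (V : finType) (H : {set {set V}}) : nat :=
  min_over (fun F : {set {set 'I_n}} => uniform r F && weakly_saturated r H F)
           (fun F => #|F|).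

Lemma wsat_exists (r n : nat) (V : finType) (H : {set {set V}}) :
  exists F : {set {set 'I_n}}, uniform r F && weakly_saturated r H F.
Proof.
exists (complete r _); rewrite /uniform subxx /weakly_saturated /=.
have D0 : complete r 'I_n :\: complete r 'I_n = set0 by rewrite setDv.
apply/existsP; exists (enum_tuple (mem (complete r 'I_n :\: complete r 'I_n))).
apply/andP; split; first by [].
by apply/forallP => -[i Hi]; exfalso; move: Hi; rewrite D0 cards0.
Qed.

Lemma delta_star_exists (r : nat) (V : finType) (H : {set {set V}}) :
  0 < r -> uniform r H -> H != set0 ->
  exists U : {set V}, (#|U| == r - 1) && (#|link H U| != 0).
Proof.
move=> r_gt0 /subsetP Hr /set0Pn[e eH].
have /eqP re : #|e| == r by move/Hr: eH; rewrite inE.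
have /card_gt0P[x xe] : 0 < #|e| by rewrite re.
exists (e :\ x); apply/andP; split.
  by move: (cardsD1 x e); rewrite xe re => ->; rewrite addKn.
rewrite -lt0n; apply/card_gt0P; exists (e :\: (e :\ x)).
by apply/imsetP; exists e; rewrite // inE eH subsetDl.
Qed.

(* Main.v *)
Require Import Defs.
From mathcomp Require Import all_boot all_order all_algebra.
From mathcomp Require Import ring lra.
Import Order.TTheory GRing.Theory Num.Theory.
Local Open Scope ring_scope.

(** Write c for the coefficient in the theorem, and call the (r-1)-sets of
    vertices faces.  When the missing edge e_i is added, it lies in a copy C_i
    of H, in which every face has codegree 0 or at least delta.  Let G_i be the
    union of C_1, ..., C_i.  Then the number of edges of F in G_i is at least
    c times the number of faces in the shadow of G_i: if A is the set of faces
    of C_i that are not in the shadow of G_{i-1}, the edges of C_i through A are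
    not in G_{i-1}, so all of them except possibly e_i belong to F; and a purely
    local bound says that if A is nonempty there are at least 1 + c |A| of them.
    Once every missing edge is added, a face outside the shadow has full
    codegree in F, and the local bound applies once more. *)

(** * Codegrees *)

Definition codegree {W : finType} (D : {set {set W}}) (U : {set W}) : nat :=
  #|[set e in D | U \subset e]|.

(* The coefficient of the theorem for (r + 1)-uniform hypergraphs. *)
Definition slope (d r : nat) : rat := d%:R / r.+1%:R - ('C(r + d, r))%:R^-1.

Definition vertex_link {W : finType} (D : {set {set W}}) (v : W) : {set {set W}} :=
  [set e :\ v | e in [set e in D | v \in e]].

Lemma setD1_inj {W : finType} (v : W) (P : {set {set W}}) :
  {in [set e in P | v \in e] &, injective (fun e : {set W} => e :\ v)}.
Proof.
move=> e1 e2; rewrite !inE => /andP[_ v1] /andP[_ v2] E.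
by rewrite -(setD1K v1) -(setD1K v2) E.
Qed.

Lemma card_vertex_link {W : finType} (D : {set {set W}}) (v : W) :
  #|vertex_link D v| = #|[set e in D | v \in e]|.
Proof. exact: card_in_imset (setD1_inj v D). Qed.

Lemma vertex_link_uniform {W : finType} (r : nat) (D : {set {set W}}) (v : W) :
  uniform r.+1 D -> uniform r (vertex_link D v).
Proof.
move=> /subsetP Dr; apply/subsetP => _ /imsetP[e + ->].
rewrite inE => /andP[/Dr]; rewrite !inE => /eqP re ve.
by move: re; rewrite (cardsD1 v) ve add1n => -[->].
Qed.

Lemma codegree_vertex_link {W : finType} (D : {set {set W}}) (v : W) (U : {set W}) :
  v \in U -> (codegree D U <= codegree (vertex_link D v) (U :\ v))%N.
Proof.
move=> vU; rewrite /codegree.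
have sub : [set e in D | U \subset e] \subset [set e in D | v \in e].
  by apply/subsetP => e; rewrite !inE => /andP[-> /subsetP ->].
rewrite -(card_in_imset (sub_in2 (subsetP sub) (setD1_inj v D))).
apply: subset_leq_card; apply/subsetP => _ /imsetP[e + ->].
rewrite !inE => /andP[eD Ue]; rewrite setSD // andbT.
by apply/imsetP; exists e; rewrite // inE eD (subsetP Ue).
Qed.

Lemma sum_card_vertex_link {W : finType} (r : nat) (D : {set {set W}}) :
  uniform r D -> (\sum_v #|vertex_link D v| = r * #|D|)%N.
Proof.
move=> /subsetP Dr.
under eq_bigr => v _ do rewrite card_vertex_link -sum1dep_card big_mkcondr.
rewrite exchange_big /= mulnC -sum_nat_const; apply: eq_bigr => e /Dr.
by rewrite inE => /eqP <-; rewrite -big_mkcond sum1_card.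
Qed.

Lemma uniform_superset {W : finType} (r : nat) (D : {set {set W}}) (U e : {set W}) :
  uniform r.+1 D -> #|U| = r -> e \in D -> U \subset e ->
  exists2 x, x \in e :\: U & e = x |: U.
Proof.
move=> /subsetP Dr Ur /Dr; rewrite inE => /eqP er Ue.
have /cards1P[x xE] : #|e :\: U| == 1%N.
  by rewrite cardsD (setIidPr Ue) er Ur subSnn.
exists x; first by rewrite xE set11.
by rewrite -xE setUC -{1}(setID e U) (setIidPr Ue).
Qed.

(** An edge containing [U] is [U] plus one vertex, so distinct edges give distinct covered vertices
    outside [U]. *)
Lemma codegree_cover {W : finType} (r : nat) (D : {set {set W}}) (U : {set W}) :
  uniform r.+1 D -> #|U| = r -> (0 < codegree D U)%N ->
  (r + codegree D U <= #|cover D|)%N.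
Proof.
move=> Dr Ur /card_gt0P[e]; rewrite inE => /andP[eD Ue].
have Uc : U \subset cover D by apply: subset_trans Ue _; apply: bigcup_sup.
rewrite -(cardsID U (cover D)) (setIidPr Uc) Ur leq_add2l.
apply: leq_trans (leq_imset_card (fun x => x |: U) _).
apply: subset_leq_card; apply/subsetP => e'; rewrite inE => /andP[e'D Ue'].
have [x] := uniform_superset _ _ _ _ Dr Ur e'D Ue'.
rewrite inE => /andP[xU xe'] ->; apply/imsetP; exists x => //.
by rewrite inE xU; apply/bigcupP; exists e'.
Qed.

Lemma codegree_complete {W : finType} (r : nat) (U : {set W}) :
  #|U| = r -> (#|W| - r <= codegree (complete r.+1 W) U)%N.
Proof.
move=> Ur; have -> : (#|W| - r)%N = #|~: U| by rewrite (cardsCs (~: U)) setCK Ur.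
have inj : {in ~: U &, injective (fun x => x |: U)}.
  move=> x y; rewrite !inE => xU yU E.
  by have := setU11 x U; rewrite E !inE (negPf xU) orbF => /eqP.
rewrite -(card_in_imset inj); apply: subset_leq_card.
apply/subsetP => _ /imsetP[x + ->]; rewrite !inE => xU.
by rewrite cardsU1 xU Ur eqxx subsetUr.
Qed.

(** Double counting of incidences: an edge of size r + 1 contains exactly r + 1 sets of size r. *)
Lemma sum_codegree {W : finType} (r : nat) (D A : {set {set W}}) :
  uniform r.+1 D -> uniform r A ->
  (\sum_(U in A) codegree D U <= r.+1 * #|D|)%N.
Proof.
move=> /subsetP Dr /subsetP Ar; rewrite /codegree.
under eq_bigr => U _ do rewrite -sum1dep_card big_mkcondr.
rewrite exchange_big /= mulnC -sum_nat_const; apply: leq_sum => e /Dr.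
rewrite inE => /eqP er; rewrite -big_mkcondr sum1dep_card.
rewrite -[leqRHS](binSn r) -er -cards_draws.
apply: subset_leq_card; apply/subsetP => U; rewrite !inE => /andP[/Ar].
by rewrite inE => -> ->.
Qed.

(* If there are more than C(r + d, r) faces, counting incidences suffices.
   Otherwise sum the bound over all vertex links: D covers at least r + 1 + d
   vertices, and each of them contributes the constant term 1. *)
Lemma codegree_edge_bound {W : finType} (d r : nat) (D A : {set {set W}}) :
  (0 < d)%N -> D != set0 -> uniform r.+1 D -> uniform r A ->
  {in A, forall U, d <= codegree D U}%N ->
  1 + #|A|%:R * slope d r <= #|D|%:R.
Proof.
move=> d0; elim: r D A => [|r IH] D A D0 Dr Ar Ad.
  (* The only possible face is the empty set, whose codegree is at most |D|, and the slope is d -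
     1. *)
  have A1 : A \subset [set set0].
    by apply/subsetP => U /(subsetP Ar); rewrite !inE cards_eq0.
  have D1 : 1 <= #|D|%:R :> rat by rewrite ler1n card_gt0.
  move: A1; rewrite subset1 => /orP[] /eqP AE; last first.
    by rewrite AE cards0 mul0r addr0.
  have dD : d%:R <= #|D|%:R :> rat.
    rewrite ler_nat; apply: leq_trans (Ad set0 _) _; first by rewrite AE set11.
    by apply: subset_leq_card; apply/subsetP => e; rewrite inE => /andP[].
  by rewrite AE cards1 /slope bin0 invr1 divr1; lra.
have D1 : (0 < #|D|)%N by rewrite card_gt0.
have [->|A0] := eqVneq A set0.
  by rewrite cards0 mul0r addr0 ler1n.
pose K : rat := ('C(r.+1 + d, r.+1))%:R.
have K0 : 0 < K by rewrite ltr0n bin_gt0 leq_addr.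
have r2 : 0 < r.+2%:R :> rat by rewrite ltr0n.
have [KA|AK] := lerP K #|A|%:R.
  have dA : d%:R * #|A|%:R <= r.+2%:R * #|D|%:R :> rat.
    rewrite -!natrM ler_nat; apply: leq_trans (sum_codegree _ _ _ Dr Ar).
    by rewrite mulnC -sum_nat_const; apply: leq_sum.
  rewrite -(ler_pM2l r2); apply: le_trans dA.
  (* Since |A| >= [K], the term -|A|/[K] coming from the slope absorbs the constant 1. *)
  have KA1 : 1 <= #|A|%:R / K by rewrite ler_pdivlMr // mul1r.
  have -> : r.+2%:R * (1 + #|A|%:R * slope d r.+1) =
            d%:R * #|A|%:R - r.+2%:R * (#|A|%:R / K - 1).
    rewrite /slope -/K; move: r.+2%:R r2 => q q0.
    by field; rewrite !gt_eqF.
  by rewrite gerBl; apply: mulr_ge0; rewrite ?ler0n ?subr_ge0.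
have coverD : (r.+1 + d <= #|cover D|)%N.
  have /set0Pn[U UA] := A0.
  have Ur : #|U| = r.+1 by have := subsetP Ar U UA; rewrite inE => /eqP.
  have dU := Ad U UA.
  apply: leq_trans (codegree_cover _ _ _ Dr Ur (leq_trans d0 dU)).
  by rewrite leq_add2l.
(* A vertex that [D] does not cover lies in no face of [A], since those have positive codegree; it
   contributes 0. *)
have link_bound v : (v \in cover D)%:R + #|vertex_link A v|%:R * slope d r
    <= #|vertex_link D v|%:R.
  case: bigcupP => [[e eD ve]|ncov].
    apply: IH; rewrite ?vertex_link_uniform //.
      by apply/set0Pn; exists (e :\ v); apply: imset_f; rewrite inE eD.
    move=> _ /imsetP[U + ->]; rewrite inE => /andP[UA vU].
    exact: leq_trans (Ad U UA) (codegree_vertex_link _ _ _ vU).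
  suff -> : vertex_link A v = set0 by rewrite cards0 mul0r addr0 ler0n.
  apply/setP => f; rewrite inE; apply/negP => /imsetP[U + _].
  rewrite inE => /andP[UA vU]; apply: ncov.
  have /card_gt0P[e] := leq_trans d0 (Ad U UA).
  by rewrite inE => /andP[eD /subsetP Ue]; exists e; rewrite ?Ue.
have {}link_bound : #|cover D|%:R + r.+1%:R * #|A|%:R * slope d r
    <= r.+2%:R * #|D|%:R.
  rewrite -!natrM -(sum_card_vertex_link _ _ Dr) -(sum_card_vertex_link _ _ Ar).
  rewrite !natr_sum mulr_suml -sum1_card natr_sum big_mkcond -big_split /=.
  by apply: ler_sum => v _; apply: le_trans (link_bound v); case: (v \in _).
rewrite -(ler_pM2l r2); apply: le_trans link_bound.
have r1 : 0 < r.+1%:R :> rat by rewrite ltr0n.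
(* This binomial identity expresses [slope d r], coming from the links, through the [K] of
   [slope d r.+1]. *)
have KK : r.+1%:R * K = (r.+1 + d)%:R * ('C(r + d, r))%:R.
  by rewrite /K -!natrM addSn -mul_bin_diag.
have K'E : ('C(r + d, r))%:R^-1 = (r.+1 + d)%:R / (r.+1%:R * K).
  by rewrite KK invfM mulrA mulfV ?mul1r // pnatr_eq0.
have d1 : 0 <= d%:R - 1 :> rat by rewrite subr_ge0 ler1n.
have AK1 : #|A|%:R / K <= 1 by rewrite ler_pdivrMr // mul1r ltW.
have cov : r.+1%:R + d%:R <= #|cover D|%:R :> rat by rewrite -natrD ler_nat.
have -> : r.+1%:R * #|A|%:R * slope d r
    = d%:R * #|A|%:R - (r.+1%:R + d%:R) * (#|A|%:R / K).
  rewrite /slope K'E natrD; move: r.+1%:R r1 => q q0.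
  by field; rewrite !gt_eqF.
have -> : r.+2%:R * (1 + #|A|%:R * slope d r.+1) =
    r.+2%:R + d%:R * #|A|%:R - r.+2%:R * (#|A|%:R / K).
  rewrite /slope -/K; move: r.+2%:R r2 => q q0.
  by field; rewrite !gt_eqF.
(* With q = |A|/[K], the two sides differ by at least (r + 1 + d)(1 - q) - (r + 2)(1 - q) = (d -
   1)(1 - q). *)
have := mulr_ge0 d1 (_ : 0 <= 1 - #|A|%:R / K); rewrite subr_ge0 => /(_ AK1).
have -> : r.+2%:R = r.+1%:R + 1 :> rat by rewrite -natr1.
move: cov; set q := #|A|%:R / K; lra.
Qed.

(** * The saturation process *)

Definition shadow {W : finType} (r : nat) (G : {set {set W}}) : {set {set W}} :=
  [set U in complete r W | [exists e in G, U \subset e]].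

Lemma shadowP {W : finType} {r : nat} {G : {set {set W}}} {U : {set W}} :
  reflect (#|U| = r /\ exists2 e, e \in G & U \subset e) (U \in shadow r G).
Proof.
rewrite !inE; apply: (iffP andP) => -[/eqP Ur].
  by move/exists_inP.
by move=> ex; split=> //; apply/exists_inP.
Qed.

Lemma shadowU {W : finType} (r : nat) (G C : {set {set W}}) :
  shadow r (G :|: C) = shadow r G :|: shadow r C.
Proof.
apply/setP => U; rewrite in_setU; apply/shadowP/orP => [[Ur [e]]|].
  by rewrite inE => /orP[] eG Ue; [left|right]; apply/shadowP; split=> //; exists e.
by case=> /shadowP[Ur [e eG Ue]]; split=> //; exists e; rewrite // inE eG ?orbT.
Qed.

Lemma shadow_uniform {W : finType} (r : nat) (G : {set {set W}}) :
  uniform r (shadow r G).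
Proof. by apply/subsetP => U; rewrite inE => /andP[]. Qed.

(** Ranging over the shadow leaves sets of codegree 0 unconstrained, just as [delta_star] ignores
    empty links. *)
Definition positive_codegree {W : finType} (d r : nat) (C : {set {set W}}) : Prop :=
  {in shadow r C, forall U, d <= codegree C U}%N.

(** Discarding the edges of [C] through no set of [A] preserves codegrees on [A], so
    [codegree_edge_bound] applies to the rest. *)
Lemma new_faces_bound {W : finType} (d r : nat) (C A : {set {set W}}) :
  (0 < d)%N -> uniform r.+1 C -> uniform r A -> A != set0 ->
  {in A, forall U, d <= codegree C U}%N ->
  1 + #|A|%:R * slope d r <= #|[set e in C | [exists U in A, U \subset e]]|%:R.
Proof.
move=> d0 Cr Ar A0 Ad; set D := [set e in C | _].
have codegD U : U \in A -> codegree D U = codegree C U.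
  move=> UA; apply: eq_card => e; rewrite !inE -andbA; congr andb.
  apply: andb_idl => Ue; by apply/exists_inP; exists U.
apply: codegree_edge_bound => //.
- have /set0Pn[U UA] := A0.
  have /card_gt0P[e] : (0 < codegree D U)%N.
    by rewrite codegD // (leq_trans d0) // Ad.
  by rewrite inE => /andP[eD _]; apply/set0Pn; exists e.
- by apply: subset_trans Cr; apply/subsetP => e; rewrite inE => /andP[].
- by move=> U UA; rewrite codegD // Ad.
Qed.

Lemma new_faces_disjoint {W : finType} (r : nat) (C G A : {set {set W}}) :
  uniform r A -> [disjoint A & shadow r G] ->
  [disjoint [set e in C | [exists U in A, U \subset e]] & G].
Proof.
move=> /subsetP Ar AG; rewrite disjoint_subset; apply/subsetP => e; rewrite !inE.
case/andP=> _ /exists_inP[U UA Ue]; apply/negP => eG.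
have /negP[] := negbT (disjointFr AG UA).
apply/shadowP; split; last by exists e.
by have := Ar U UA; rewrite inE => /eqP.
Qed.

(** Only the edges of [F] inside [G] are counted, so that those found at a later step are new. *)
Lemma process_bound {W : finType} (d r : nat) (F : {set {set W}})
    (s : seq {set W}) :
  (0 < d)%N ->
  (forall i, (i < size s)%N -> exists C : {set {set W}},
     [/\ uniform r.+1 C, positive_codegree d r C, nth set0 s i \in C
       & C \subset F :|: [set e in take i.+1 s]]) ->
  forall i, (i <= size s)%N -> exists G : {set {set W}},
    [set e in take i s] \subset G /\
    #|shadow r G|%:R * slope d r <= #|F :&: G|%:R.
Proof.
move=> d0 step; elim=> [|i IH] i_s.
  exists set0; split; first by apply/subsetP => e; rewrite inE take0.
  suff -> : shadow r set0 = set0 :> {set {set W}} by rewrite cards0 mul0r.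
  apply/setP => U; rewrite [RHS]inE; apply/negP => /shadowP[_ [e]].
  by rewrite inE.
have [G [sG Gbound]] := IH (ltnW i_s).
have [C [Cr Cd eC CF]] := step i i_s.
have takeE : [set e in take i.+1 s] = nth set0 s i |: [set e in take i s].
  by apply/setP => e; rewrite !inE (take_nth set0) // mem_rcons inE.
exists (G :|: C); split.
  by rewrite takeE setUC setUSS // sub1set.
pose A := shadow r C :\: shadow r G.
have cardU : #|shadow r (G :|: C)| = (#|shadow r G| + #|A|)%N.
  by rewrite shadowU -(cardsID (shadow r G) (_ :|: _)) setUK setDUl setDv set0U.
have [A0|A0] := eqVneq A set0.
  rewrite cardU A0 cards0 addn0; apply: le_trans Gbound _.
  by rewrite ler_nat subset_leq_card // setIS // subsetUl.
have Ar : uniform r A.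
  by apply: subset_trans (subsetDl _ _) _; apply: shadow_uniform.
have Ad : {in A, forall U, d <= codegree C U}%N.
  by move=> U; rewrite inE => /andP[_ /Cd].
have := new_faces_bound _ _ _ _ d0 Cr Ar A0 Ad.
set D := [set e in C | _] => Dbound.
have DG : [disjoint D & G].
  by apply: (new_faces_disjoint _ _ _ _ Ar); rewrite disjoints_subset subsetDr.
(* An edge of [C] outside [F] was added by now; if added earlier it lies in [G], which [D]
   avoids. *)
have DF : D :\ nth set0 s i \subset F :&: C.
  apply/subsetP => e; rewrite in_setD1 => /andP[ne eD].
  have eC' : e \in C by move: eD; rewrite inE => /andP[].
  rewrite inE eC' andbT; have := subsetP CF e eC'.
  rewrite takeE in_setU in_setU1 (negPf ne) /= => /orP[//|/(subsetP sG) eG].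
  by rewrite (disjointFr DG eD) in eG.
(* The edge just added may be missing from [F]; the constant 1 in [Dbound] pays for this loss. *)
have FGC : (#|F :&: G| + #|D| <= #|F :&: (G :|: C)|.+1)%N.
  rewrite (cardsD1 (nth set0 s i) D) addnCA -add1n leq_add ?leq_b1 //.
  rewrite -cardsUI; set I := _ :&: (D :\ _).
  have -> : I = set0.
    apply/setP => e; rewrite !inE; apply/negP => /andP[/andP[_ eG] /andP[_ eD]].
    by move: eG; rewrite (disjointFr DG) // inE.
  by rewrite cards0 addn0 subset_leq_card // setIUr setUS.
have {}FGC : #|F :&: G|%:R + #|D|%:R <= #|F :&: (G :|: C)|%:R + 1 :> rat.
  by rewrite -natrD natr1 ler_nat.
rewrite cardU natrD mulrDl; lra.
Qed.

(** * Copies of H *)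

(** A face of the copy is the image of its preimage, and [f] maps the edges through the latter
    injectively to edges through the former. *)
Lemma image_edges_positive_codegree {V W : finType} (d r : nat)
    (H : {set {set V}}) (f : {ffun V -> W}) :
  injective f -> positive_codegree d r H ->
  positive_codegree d r (image_edges f H).
Proof.
move=> fI Hd U' /shadowP[U'r [_ /imsetP[e eH ->] U'e]].
pose U := f @^-1: U'.
have U'E : U' = f @: U.
  apply/setP => y; apply/idP/imsetP => [yU|[x + ->]]; last by rewrite inE.
  have /imsetP[x xe yE] := subsetP U'e y yU.
  by exists x; rewrite // inE -yE.
have Ud : (d <= codegree H U)%N.
  apply: Hd; apply/shadowP; split; first by rewrite -U'r U'E card_imset.
  exists e => //; apply/subsetP => x; rewrite inE => /(subsetP U'e).
  by rewrite (mem_imset _ _ fI).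
apply: leq_trans Ud _; rewrite /codegree -(card_imset _ (imset_inj fI)).
apply: subset_leq_card; apply/subsetP => _ /imsetP[g + ->].
rewrite inE => /andP[gH Ug]; rewrite inE U'E imsetS // andbT.
by apply/imsetP; exists g.
Qed.

Lemma image_edges_uniform {V W : finType} (r : nat) (H : {set {set V}})
    (f : {ffun V -> W}) :
  injective f -> uniform r H -> uniform r (image_edges f H).
Proof.
move=> fI /subsetP Hr; apply/subsetP => _ /imsetP[e /Hr + ->].
by rewrite !inE card_imset.
Qed.

(** A set in the shadow has a non-empty link, so the minimum ranges over it; a link is an image of
    the edges counted by the codegree. *)
Lemma delta_star_codegree {V : finType} (r : nat) (H : {set {set V}}) :
  positive_codegree (delta_star r.+1 H) r H.
Proof.
move=> U /shadowP[Ur [e eH Ue]].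
have UP : (#|U| == r.+1 - 1)%N && (#|link H U| != 0)%N.
  rewrite subn1 Ur eqxx -lt0n; apply/card_gt0P; exists (e :\: U).
  by apply/imsetP; exists e; rewrite // inE eH.
rewrite /delta_star; case: eqP => // _.
have [_ [_ _ /(_ U UP) le_d]] :=
  @min_overP _ (fun U : {set V} => (#|U| == r.+1 - 1)%N && (#|link H U| != 0)%N)
    (fun U : {set V} => #|link H U|) U UP.
exact: leq_trans le_d (leq_imset_card _ _).
Qed.

(** This gives r + d <= n, which makes the codegrees in the complete hypergraph on n vertices at
    least d. *)
Lemma delta_star_card {V : finType} (r : nat) (H : {set {set V}}) :
  uniform r.+1 H -> (0 < delta_star r.+1 H)%N ->
  (r + delta_star r.+1 H <= #|V|)%N.
Proof.
move=> Hr d0.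
have H0 : H != set0 by apply: contraTneq d0 => ->; rewrite /delta_star eqxx.
have /set0Pn[e eH] := H0.
have /eqP er : #|e| == r.+1 by have := subsetP Hr e eH; rewrite inE.
have /card_gt0P[x xe] : (0 < #|e|)%N by rewrite er.
have Ur : #|e :\ x| = r by move: er; rewrite (cardsD1 x) xe add1n => -[].
have dU : (delta_star r.+1 H <= codegree H (e :\ x))%N.
  apply: delta_star_codegree; apply/shadowP; split=> //.
  by exists e; rewrite ?subsetDl.
apply: leq_trans (max_card (mem (cover H))).
apply: leq_trans (codegree_cover _ _ _ Hr Ur (leq_trans d0 dU)).
by rewrite leq_add2l.
Qed.

(** * The lower bound for weakly saturated hypergraphs *)

Lemma weakly_saturated_bound {V W : finType} (d r : nat) (H : {set {set V}})
    (F : {set {set W}}) :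
  (0 < d)%N -> uniform r.+1 H -> positive_codegree d r H ->
  (r + d <= #|W|)%N -> weakly_saturated r.+1 H F ->
  'C(#|W|, r)%:R * slope d r <= #|F|%:R.
Proof.
move=> d0 Hr Hd Wd /existsP[s /andP[sE /forallP sP]].
have step i : (i < size s)%N -> exists C : {set {set W}},
    [/\ uniform r.+1 C, positive_codegree d r C, nth set0 s i \in C
      & C \subset F :|: [set e in take i.+1 s]].
  rewrite size_tuple => i_s.
  have /existsP[f /and3P[/injectiveP fI CF eC]] := sP (Ordinal i_s).
  exists (image_edges f H); split=> //.
  - exact: image_edges_uniform.
  - exact: image_edges_positive_codegree.
  - by move: eC; rewrite (tnth_nth set0).
have [G [sG Gbound]] := process_bound _ _ _ _ d0 step _ (leqnn _).
have CG : complete r.+1 W :\: F \subset G.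
  apply: subset_trans sG; apply/subsetP => e eN.
  by rewrite inE take_size (perm_mem sE) mem_enum.
pose A := complete r W :\: shadow r G.
have cardA : 'C(#|W|, r) = (#|shadow r G| + #|A|)%N.
  rewrite -card_draws -/(complete r W) -(cardsID (shadow r G) (complete r W)).
  by congr (_ + _)%N; rewrite (setIidPr (shadow_uniform _ _)).
have [A0|A0] := eqVneq A set0.
  rewrite cardA A0 cards0 addn0; apply: le_trans Gbound _.
  by rewrite ler_nat subset_leq_card // subsetIl.
have Ar : uniform r A by apply: subsetDl.
(* The complete hypergraph plays the role of a last copy, whose new faces are those that the process
   never reached. *)
have Ad : {in A, forall U, d <= codegree (complete r.+1 W) U}%N.
  move=> U /(subsetP Ar); rewrite inE => /eqP Ur.
  apply: leq_trans (codegree_complete _ _ Ur).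
  by rewrite leq_subRL ?(leq_trans _ Wd) ?leq_addr.
have := new_faces_bound _ _ _ _ d0 (subxx _) Ar A0 Ad.
set D := [set e in _ | _] => Dbound.
have DG : [disjoint D & G].
  by apply: (new_faces_disjoint _ _ _ _ Ar); rewrite disjoints_subset subsetDr.
(* All missing edges are in [G], so an edge avoiding [G] belongs to [F]; this time no edge is
   lost. *)
have DF : D \subset F :\: G.
  apply/subsetP => e eD; rewrite inE (disjointFr DG eD) /=.
  apply: contraFT (disjointFr DG eD) => eF; apply: (subsetP CG).
  by rewrite inE eF; move: eD; rewrite inE => /andP[].
have : #|F :&: G|%:R + #|D|%:R <= #|F|%:R :> rat.
  by rewrite -natrD ler_nat -(cardsID G F) leq_add2l subset_leq_card.
rewrite cardA natrD mulrDl; lra.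
Qed.

Theorem theorem1p8 (r delta : nat) (V : finType) (H : {set {set V}}) :
  (1 <= r)%N -> (1 <= delta)%N ->
  uniform r H -> delta_star r H = delta ->
  forall n : nat, (#|V| <= n)%N ->
  (delta%:R / r%:R - ('C(r + delta - 1, r - 1))%:R^-1) * ('C(n, r - 1))%:R
    <= (wsat r n H)%:R :> rat.
Proof.
(* From here [r] is the size of a face, one less than that of an edge. *)
case: r => // r _ d0 Hr dE n Vn; rewrite addSn !subn1 /= -/(slope delta r) mulrC.
have [F0 F0P] := wsat_exists r.+1 n H.
rewrite /wsat; have [F [/andP[_ Fsat] <- _]] :=
  @min_overP _ (fun F : {set {set 'I_n}} => uniform r.+1 F && weakly_saturated r.+1 H F)
    (fun F => #|F|) F0 F0P.
have Hd := delta_star_codegree r H; rewrite dE in Hd.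
have Vd : (r + delta <= #|'I_n|)%N.
  by rewrite card_ord (leq_trans _ Vn) // -dE delta_star_card // dE.
by have := weakly_saturated_bound _ _ _ _ d0 Hr Hd Vd Fsat; rewrite card_ord.
Qed.
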